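(* Let $(X,\kappa)$ be a connected digital image. Let $A$ be a freezing set for $(X,\kappa)$. Let $x_0 \in X$ be a point that has degree $1$ in $(X,\kappa)$. Then $x_0 \in A$.
   Context: A digital image $(X,\kappa)$ is a set $X \subset \mathbb{Z}^n$ (for some $n \in \mathbb{N}$) together with an adjacency relation $\kappa$ on pairs of distinct points of $X$, i.e. $(X,\kappa)$ is a (simple, undirected) graph with vertex set $X$. Write $x \leftrightarrow_\kappa y$ if $x,y$ are $\kappa$-adjacent. The image $(X,\kappa)$ is connected if for all $a,b\in X$ there is a $\kappa$-path from $a$ to $b$, i.e. a finite sequence $\{y_i\}_{i=0}^m$ in $X$ with $y_0=a$, $y_m=b$, and, for $0\le i<m$, $y_i=y_{i+1}$ or $y_i\leftrightarrow_\kappa y_{i+1}$. For $x \in X$ let $N(X,x,\kappa)=\{y\in X \mid x \leftrightarrow_\kappa y\}$; the degree of $x$ in $(X,\kappa)$ is $\#N(X,x,\kappa)$, where $\#$ denotes cardinality. A function $f: X\to X$ is $\kappa$-continuous if it maps $\kappa$-connected subsets to $\kappa$-connected subsets; equivalently, $x \leftrightarrow_\kappa x'$ implies $f(x)=f(x')$ or $f(x)\leftrightarrow_\kappa f(x')$. $C(X,\kappa)$ is the set of $\kappa$-continuous functions $X \to X$, and $\mathrm{Fix}(f)=\{x\in X\mid f(x)=x\}$. A set $A\subset X$ is a freezing set for $(X,\kappa)$ if for every $g\in C(X,\kappa)$, $A\subset \mathrm{Fix}(g)$ implies $g=\mathrm{id}_X$. *)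

(* Defs.v *)
From mathcomp Require Import all_boot all_order all_algebra.
From mathcomp Require Import boolp classical_sets functions cardinality.

Set Implicit Arguments.
Unset Strict Implicit.
Unset Printing Implicit Defensive.

Local Open Scope classical_set_scope.
Local Open Scope card_scope.

Record digital_image (n : nat) := DigitalImage {
  points : set 'rV[int]_n ;
  adj : points -> points -> Prop ;
  adj_irr : forall x, ~ adj x x ;
  adj_sym : forall x y, adj x y -> adj y x }.

Section DigitalImageTheory.
Variables (n : nat) (I : digital_image n).
Implicit Types (x y : points I) (Y A : set (points I)).

(* Only the values y 0, ..., y m of the sequence matter. *)
Definition path_in Y a b :=
  exists (m : nat) (y : nat -> points I),
    [/\ y 0%N = a, y m = b,
        forall i, (i <= m)%N -> Y (y i) &
        forall i, (i < m)%N -> y i = y i.+1 \/ adj (y i) (y i.+1)].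

Definition connected_subset Y := forall a b, Y a -> Y b -> path_in Y a b.

Definition connected_image := connected_subset [set: points I].

Definition neighbors x : set (points I) := [set y | adj x y].

(* The image may be infinite, so a point need not have a finite degree. *)
Definition has_degree x (d : nat) : Prop := neighbors x #= `I_d.

Definition digitally_continuous (f : points I -> points I) :=
  forall Y, connected_subset Y -> connected_subset (f @` Y).

Definition Fix (f : points I -> points I) : set (points I) :=
  [set x | f x = x].

Definition freezing_set A :=
  forall g, digitally_continuous g -> A `<=` Fix g -> g = id.

End DigitalImageTheory.

Arguments connected_image {n} I.

(* Main.v *)
Require Import Defs.
From mathcomp Require Import all_boot all_order all_algebra.
From mathcomp Require Import boolp classical_sets functions cardinality.

Local Open Scope classical_set_scope.
Local Open Scope card_scope.

(** A leaf [x0] can be folded onto its only neighbor [x1]: the edge between them collapses and every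
    other edge is kept, so the fold is continuous by [adjacency_preserving_continuous]. A freezing
    set must contain a point moved by this map, and only [x0] moves. *)

Lemma card_eq_II1 (T : Type) (Y : set T) :
  Y #= `I_1 -> exists x, Y = [set x].
Proof.
move=> /card_set_bijP[f [fY finj fsurj]].
have [x Yx _] : (f @` Y) 0%N by apply: fsurj.
exists x; apply/seteqP; split=> [y Yy|_ -> //].
apply: finj; rewrite ?inE //.
have := fY _ Yx; have := fY _ Yy => /=.
by rewrite !ltnS !leqn0 => /eqP -> /eqP ->.
Qed.

(** Composing a path with [f] gives a path of the same length, because path steps may be
    stationary. *)
Lemma adjacency_preserving_continuous (n : nat) (I : digital_image n)
    (f : points I -> points I) :
  (forall x y, adj x y -> f x = f y \/ adj (f x) (f y)) ->
  digitally_continuous f.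
Proof.
move=> fadj Y Ycon _ _ [a Ya <-] [b Yb <-].
have [m [y [y0 ym yY ystep]]] := Ycon a b Ya Yb.
exists m, (f \o y); split=> /= [||i im|i im].
- by rewrite y0.
- by rewrite ym.
- by exists (y i) => //; apply: yY.
- by have [->|/fadj] := ystep i im; [left|].
Qed.

(* If x0 is not in A, retracting x0 onto its unique neighbor and fixing every
   other point is continuous and fixes A, but is not the identity. *)
Theorem theorem3p1 (n : nat) (I : digital_image n) (A : set (points I))
    (x0 : points I) :
  connected_image I -> freezing_set A -> has_degree x0 1 -> A x0.
Proof.
move=> _ Afreeze /card_eq_II1[x1 Nx0].
have adjx0 y : adj x0 y -> y = x1.
  by move=> x0y; have : neighbors x0 y by []; rewrite Nx0.
have x0x1 : adj x0 x1 by have : [set x1] x1 by []; rewrite -Nx0.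
apply: contrapT => nAx0.
pose g (x : points I) := if `[< x = x0 >] then x1 else x.
have gx0 : g x0 = x1 by rewrite /g asboolT.
have gN x : x <> x0 -> g x = x by move=> xx0; rewrite /g asboolF.
have gid : g = id.
  apply: Afreeze => [|x Ax]; last by apply: gN => xx0; rewrite xx0 in Ax.
  apply: adjacency_preserving_continuous => x y.
  (* Only edges with exactly one end at [x0] need the degree: the other end is [x1], so [g]
     collapses them. *)
  have [->|xx0] := pselect (x = x0); have [->|yx0] := pselect (y = x0).
  - by left.
  - by move=> /adjx0 yx1; left; rewrite gx0 gN.
  - by move=> /adj_sym /adjx0 xx1; left; rewrite gx0 gN.
  - by right; rewrite !gN.
(* With [g = id], [x1 = g x0 = x0], so the edge from [x0] to [x1] is a loop. *)
apply: (@adj_irr _ _ x0).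
by have := x0x1; rewrite -gx0 gid.
Qed.
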